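(* Let $G$ be an arbitrary group, let $n\ge 1$, let $(g_1,\dots,g_n)\in G^n$ be an $n$-tuple of pairwise distinct elements, and let $K$ be a unital associative commutative ring. Let $R$ be the algebra of generic matrices associated with the elementary grading of $n\times n$ matrices induced by $(g_1,\dots,g_n)$. Let $U$ be the $T_G$-ideal of $K\langle X\rangle$ generated by the following polynomials (for all choices of variables with the indicated degrees): (1) $x_1x_2-x_2x_1$, where $\alpha(x_1)=\alpha(x_2)=e$; (2) $x_1x_2x_3-x_3x_2x_1$, where $\alpha(x_1)=\alpha(x_3)=(\alpha(x_2))^{-1}\neq e$; (3) $x_1$, where $R_{\alpha(x_1)}=\{0\}$; (4) the multilinear Type 1-monomials which are graded identities of $R$ and whose ordinary degree (length) is at most $\lambda$, where $s=|\mathrm{Supp}_G(R)|$ and $\lambda=(s+1)\left[(s+1)\left(\sum_{i=1}^{s}(s-1)^i\right)+1\right]$. Then $T_G(R)=U$. Moreover, if $K$ is an infinite integral domain, then $T_G(M_n(K))=U$.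
   Context: $e$ is the identity of $G$. $X=\bigcup_{g\in G}X_g$ is a disjoint union of countably infinite sets, and $K\langle X\rangle$ is the free (unital) associative $K$-algebra on $X$. A variable $x\in X_g$ has degree $\alpha(x)=g$; a monomial is a variable or a product of variables, and $\alpha(x_{i_1}\cdots x_{i_k})=\alpha(x_{i_1})\cdots\alpha(x_{i_k})$. $K\langle X\rangle_g$ is the $K$-span of monomials of degree $g$; this makes $K\langle X\rangle$ a $G$-graded algebra. A $G$-graded endomorphism $\phi$ satisfies $\phi(K\langle X\rangle_g)\subset K\langle X\rangle_g$ for all $g$. A $T_G$-ideal is a graded two-sided ideal invariant under all $G$-graded endomorphisms; the $T_G$-ideal generated by a set is the intersection of all $T_G$-ideals containing it. For a $G$-graded algebra $A=\bigoplus_g A_g$, $\mathrm{Supp}_G(A)=\{g\in G: A_g\ne\{0\}\}$, and $T_G(A)$ is the set of graded identities: $f(x_1,\dots,x_m)$ with $f(a_1,\dots,a_m)=0$ for all $a_i\in A_{\alpha(x_i)}$. Elementary grading: for any commutative ring $S$, $M_n(S)$ is graded by letting the matrix unit $e_{ij}$ have degree $g_i^{-1}g_j$; $M_n(K)$ and $M_n(\Omega)$ below carry this grading. Generic matrices: let $\Omega=K[Y]$ be the polynomial ring in the commuting variables $y_{h,i}^{k}$ ($h\in G$, $i\ge1$, $1\le k\le n$). For $h\in G$ let $L_h=\{k: g_kh\in\{g_1,\dots,g_n\}\}$ and, for $k\in L_h$, let $s_h^k$ be the index with $g_{s_h^k}=g_kh$. The generic matrix of degree $h$ is $A_i^h=\sum_{k\in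 L_h}y_{h,i}^k e_{k,s_h^k}\in M_n(\Omega)$. $R$ is the $G$-graded $K$-subalgebra of $M_n(\Omega)$ generated by all generic matrices. A monomial $x_{i_1}\cdots x_{i_l}$ is multilinear if its variables are pairwise distinct. A subword of it is a product of consecutive letters. A Type 1-monomial is a monomial all of whose non-empty subwords have degree in $\mathrm{Supp}_G(R)$. *)

(* Defs.v *)
From HB Require Import structures.
From mathcomp Require Import all_boot all_order all_algebra.
From mathcomp Require Import finmap.
From mathcomp Require Import boolp classical_sets cardinality.
From mathcomp.multinomials Require Import monalg.

Set Implicit Arguments.
Unset Strict Implicit.
Unset Printing Implicit Defensive.

Import GRing.Theory.
Local Open Scope classical_set_scope.
Local Open Scope ring_scope.

(* X is the disjoint union over g : G of the countably infinite sets
   X_g = {(g, i) | i : nat}. *)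
Definition var (G : groupType) : choiceType := (G * nat)%type.
Definition alpha (G : groupType) (x : var G) : G := x.1.

(* The empty word, i.e. the monomial 1, has degree e. *)
Definition deg (G : groupType) (w : seq (var G)) : G :=
  (\prod_(x <- w) alpha x)%g.

Notation "{ 'freealg' K [ G ] }" := {malg K[{fmonom (var G)}]}
  (at level 0, format "{ 'freealg'  K [ G ] }") : type_scope.

Definition X_ (G : groupType) (K : comNzRingType) (x : var G) : {freealg K[G]} :=
  << fmu x >>.

Definition mon (G : groupType) (K : comNzRingType) (w : seq (var G)) :
    {freealg K[G]} :=
  \prod_(x <- w) X_ K x.

(* A grading on a module A is given by its family of homogeneous components
   Ag : G -> set A.  A subset is graded when each of its elements is a finite
   sum of homogeneous elements of the subset. *)
Definition graded_subset (G : groupType) (A : nmodType) (Ag : G -> set A)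
    (B : set A) : Prop :=
  forall b, B b -> exists s : seq A,
    (forall a, a \in s -> B a /\ exists g, Ag g a) /\ b = \sum_(a <- s) a.

Definition Supp (G : groupType) (A : nmodType) (Ag : G -> set A) : set G :=
  [set g | exists2 a, Ag g a & a != 0].

Definition free_comp (G : groupType) (K : comNzRingType) (g : G) :
    set {freealg K[G]} :=
  [set f | exists s : seq (K * seq (var G)),
     (forall p, p \in s -> deg p.2 = g) /\
     f = \sum_(p <- s) p.1 *: mon K p.2].

Arguments free_comp G K g _ : clear implicits.

Definition TG_ideal (G : groupType) (K : comNzRingType)
    (I : set {freealg K[G]}) : Prop :=
  [/\ I 0,
      forall a b, I a -> I b -> I (a + b),
      forall a b, I a -> I (b * a) /\ I (a * b),
      graded_subset (free_comp G K) I
    & forall phi : {lrmorphism {freealg K[G]} -> {freealg K[G]}},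
        (forall g a, free_comp G K g a -> free_comp G K g (phi a)) ->
        forall a, I a -> I (phi a)].

(* A K-algebra is presented as a ring A with its structure morphism
   iota : K -> A.  Evaluation f(v) of f in K<X> at v : X -> A. *)
Definition feval (G : groupType) (K : comNzRingType) (A : pzRingType)
    (iota : {rmorphism K -> A}) (v : var G -> A) (f : {freealg K[G]}) : A :=
  \sum_(w <- msupp f) iota f@_w * \prod_(x <- (w : seq (var G))) v x.

Definition TG (G : groupType) (K : comNzRingType) (A : pzRingType)
    (iota : {rmorphism K -> A}) (Ag : G -> set A) : set {freealg K[G]} :=
  [set f | forall v : var G -> A,
     (forall x, Ag (alpha x) (v x)) -> feval iota v f = 0].

Definition graded_subalgebra (G : groupType) (K : comNzRingType)
    (A : pzRingType) (iota : {rmorphism K -> A}) (Ag : G -> set A)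
    (B : set A) : Prop :=
  [/\ B 1,
      forall a b, B a -> B b -> B (a + b),
      forall a b, B a -> B b -> B (a * b),
      forall c a, B a -> B (iota c * a)
    & graded_subset Ag B].

Definition elem_comp (G : groupType) (n : nat) (gs : 'I_n -> G)
    (S : comNzRingType) (g : G) : set 'M[S]_n :=
  [set A | forall i j, A i j != 0 -> ((gs i)^-1 * gs j)%g = g].
Arguments elem_comp {G n} gs S g _.

Section GenericMatrices.
Context (G : groupType) (n : nat) (gs : 'I_n -> G) (K : comNzRingType).

Definition Omega : comNzRingType := {malg K[{cmonom (G * nat * 'I_n)%type}]}.

(* Structure morphisms of the K-algebras M_n(Omega) and M_n(K). *)
Definition iotaOmega : {rmorphism K -> 'M[Omega]_n} :=
  @scalar_mx Omega n
    \o (@mkmalgU {cmonom (G * nat * 'I_n)%type} K mone :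
          {rmorphism K -> Omega}).
Definition iotaK : {rmorphism K -> 'M[K]_n} := @scalar_mx K n.

Definition y_ (h : G) (i : nat) (k : 'I_n) : Omega := << ucm (h, i, k) >>.

(* When gs is injective, the inner sum is empty if k is not in L_h, and its
   only index is j = s_h^k otherwise. *)
Definition gen_mx (h : G) (i : nat) : 'M[Omega]_n :=
  \sum_(k < n) \sum_(j < n | gs j == (gs k * h)%g) y_ h i k *: delta_mx k j.

Definition R_alg : set 'M[Omega]_n :=
  smallest (graded_subalgebra iotaOmega (elem_comp gs Omega))
           [set A | exists h i, A = gen_mx h i].

Definition R_comp (g : G) : set 'M[Omega]_n :=
  R_alg `&` elem_comp gs Omega g.

Lemma finite_Supp_R : finite_set (Supp R_comp).
Proof.
apply: (@sub_finite_set _ _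
  [set ((gs p.1)^-1 * gs p.2)%g | p in [set: 'I_n * 'I_n]]); last first.
  exact/finite_image/finite_finset.
move=> g [A [_ Ag]] /eqP An0; apply: contrapT => gN; apply: An0.
apply/matrixP => i j; rewrite mxE; apply/eqP; apply: contrapT => /negP Aij.
by apply: gN; exists (i, j) => //=; apply: Ag.
Qed.

Definition type1 (w : seq (var G)) : Prop :=
  forall v, infix v w -> v != [::] -> Supp R_comp (deg v).

Definition s_card : nat := #|` fset_set (Supp R_comp)|%fset.

Definition lambda : nat :=
  ((s_card + 1) *
   ((s_card + 1) * (\sum_(1 <= i < s_card.+1) (s_card - 1) ^ i) + 1))%N.

Definition gen1 : set {freealg K[G]} :=
  [set f | exists x1 x2 : var G,
     [/\ alpha x1 = 1%g, alpha x2 = 1%g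
       & f = X_ K x1 * X_ K x2 - X_ K x2 * X_ K x1]].

Definition gen2 : set {freealg K[G]} :=
  [set f | exists x1 x2 x3 : var G,
     [/\ alpha x1 = alpha x3, alpha x3 = ((alpha x2)^-1)%g,
         ((alpha x2)^-1)%g <> 1%g
       & f = X_ K x1 * X_ K x2 * X_ K x3 - X_ K x3 * X_ K x2 * X_ K x1]].

Definition gen3 : set {freealg K[G]} :=
  [set f | exists2 x : var G, R_comp (alpha x) = [set 0] & f = X_ K x].

Definition gen4 : set {freealg K[G]} :=
  [set f | exists w : seq (var G),
     [/\ [/\ w != [::], uniq w & type1 w],
         TG iotaOmega R_comp (mon K w), (size w <= lambda)%N
       & f = mon K w]].

Definition U_ideal : set {freealg K[G]} :=
  smallest (@TG_ideal G K) (gen1 `|` gen2 `|` gen3 `|` gen4).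

End GenericMatrices.
Arguments R_comp {G n} gs K g _.
Arguments U_ideal {G n} gs K _.

(* Main.v *)
Require Import Defs.
From HB Require Import structures.
From mathcomp Require Import all_boot all_order all_algebra.
From mathcomp Require Import finmap.
From mathcomp Require Import boolp classical_sets cardinality.
From mathcomp.multinomials Require Import monalg.

Set Implicit Arguments.
Unset Strict Implicit.
Unset Printing Implicit Defensive.

Import GRing.Theory.
Local Open Scope classical_set_scope.
Local Open Scope ring_scope.

(** Evaluating a word x_1 ... x_l at generic matrices amounts to walking in G: from row
    k the walk visits g_k, g_k a_1, g_k a_1 a_2, ... (a_j the degree of x_j), and the
    row contributes one term if the walk stays inside {g_1, ..., g_n} and 0
    otherwise.  The monomial of that term records exactly the multiset of edges
    (letter, source vertex) of the walk.  So f vanishes at the generic matrices iff,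
    for each k, the coefficients of the words whose walk from k stays inside sum to
    zero over each class of words with the same edges.  Two facts then show that f
    lies in every T_G-ideal I containing the generators.

    Words with the same edges are congruent modulo (1) and (2) (trail_congr,
    same_edges_congr).  They are Eulerian trails of the same directed multigraph with
    the same origin, and any two of these are linked by swaps
    u1 u2 u3 -> u3 u2 u1 with deg u1 = deg u3 = (deg u2)^-1: these are
    instances of (2), or of (1) when the degrees are trivial.

    Words that admit no walk from any row lie in I (dead_mon).  Cut such a word into
    blocks.  If some run of blocks has its degree outside Supp(R), then (3) applies to
    it.  Otherwise all the positions reached lie in Supp(R), so that with more than
    s = |Supp(R)| blocks a position other than the last is visited twice; gluing the
    two blocks that meet at its second visit keeps the set of visited positions, hence
    keeps the word dead.  So one comes down to at most s blocks, and s <= lambda: the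
    multilinear word with the degrees of the blocks is a generator (4).

    Conversely the generators are identities of M_n(S) for each commutative K-algebra
    S, and identities form a T_G-ideal.  Only one property of the matrices used for
    evaluation matters for the other inclusion, namely that the monomials in their
    entries are linearly independent (separating).  It holds for the generic matrices
    by definition of Omega, and over an infinite domain K for the family of all
    homogeneous matrices over K, since a polynomial that vanishes everywhere is zero. *)

(** * Evaluation and substitution in the free algebra *)

Section Evaluation.
Context (G : groupType) (K : comNzRingType).
Implicit Types (f : {freealg K[G]}) (u v w : seq (var G)).

Lemma deg_nil : deg [::] = 1%g :> G.
Proof. exact: big_nil. Qed.

Lemma deg_cons (x : var G) w : deg (x :: w) = (alpha x * deg w)%g.
Proof. exact: big_cons. Qed.

Lemma deg_cat w w' : deg (w ++ w') = (deg w * deg w')%g.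
Proof. exact: big_cat. Qed.

Lemma degE w : deg w = (\prod_(h <- map (@alpha G) w) h)%g.
Proof. by rewrite big_map. Qed.

Lemma mon_cat w w' : mon K (w ++ w') = mon K w * mon K w'.
Proof. exact: big_cat. Qed.

Lemma mon_cons (x : var G) w : mon K (x :: w) = X_ K x * mon K w.
Proof. exact: big_cons. Qed.

Lemma mon_nil : mon K [::] = 1 :> {freealg K[G]}.
Proof. exact: big_nil. Qed.

Lemma mon1 (x : var G) : mon K [:: x] = X_ K x.
Proof. by rewrite mon_cons mon_nil mulr1. Qed.

Lemma mon2 (x y : var G) : mon K [:: x; y] = X_ K x * X_ K y.
Proof. by rewrite mon_cons mon1. Qed.

Lemma mon3 (x y z : var G) : mon K [:: x; y; z] = X_ K x * X_ K y * X_ K z.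
Proof. by rewrite mon_cons mon2 mulrA. Qed.

Lemma mon_cat3 u v w : mon K (u ++ v ++ w) = mon K u * mon K v * mon K w.
Proof. by rewrite mon_cat mon_cat mulrA. Qed.

Lemma mon_flatten (us : seq (seq (var G))) :
  mon K (flatten us) = \prod_(u <- us) mon K u.
Proof.
by elim: us => [|u us IH]; rewrite ?big_nil ?mon_nil // big_cons mon_cat IH.
Qed.

Lemma malgUZ (c : K) (m : {fmonom (var G)}) :
  << c *g m >> = c *: << m >> :> {freealg K[G]}.
Proof. by apply/malgP => k; rewrite mcoeffZ 2!mcoeffU mulr_natr. Qed.

Lemma monE w : mon K w = << FMonom w >>.
Proof.
elim: w => [|x w IH]; first by rewrite mon_nil -fmoneE.
by rewrite mon_cons IH malgM_def fgmulUU mulr1 fmuE; congr << _ >>; apply/eqP; rewrite fmP fmM.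
Qed.

Lemma freealg_sum f : f = \sum_(w <- msupp f) f@_w *: mon K w.
Proof.
rewrite {1}[f]monalgE; apply: eq_bigr => w _.
by rewrite malgUZ monE fmK.
Qed.

Lemma freealg_scaleAr (c : K) f g : f * (c *: g) = c *: (f * g).
Proof.
apply/malgP => k; rewrite (@mcoeffMlw _ _ (msupp f) (msupp g)) ?msuppZ_le //.
rewrite mcoeffZ mcoeffMl mulr_sumr.
apply: eq_bigr => w _; rewrite mulr_sumr; apply: eq_bigr => w' _.
by rewrite mcoeffZ mulrCA mulrnAr.
Qed.

(** The matrix algebras of interest may have any size, so that evaluation is studied
    in an arbitrary ring in which the scalars are central. *)
Section Feval.
Context (A : pzRingType) (iota : {rmorphism K -> A}).
Hypothesis iota_central : forall c a, iota c * a = a * iota c.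
Variable v : var G -> A.
Local Notation ev := (feval iota v).

Lemma fevalEw (d : {fset {fmonom (var G)}}) f : (msupp f `<=` d)%fset ->
  ev f = \sum_(w <- d) iota f@_w * \prod_(x <- (w : seq (var G))) v x.
Proof.
move=> le; rewrite [LHS](big_fset_incl _ le) => //= w _ /mcoeff_outdom ->.
by rewrite rmorph0 mul0r.
Qed.

Lemma fevalD : {morph ev : f g / f + g}.
Proof.
move=> f g; set d := (msupp f `|` msupp g)%fset.
rewrite (@fevalEw d) ?msuppD_le // (@fevalEw d) ?fsubsetUl //.
rewrite (@fevalEw d) ?fsubsetUr // -big_split; apply: eq_bigr => w _ /=.
by rewrite mcoeffD rmorphD mulrDl.
Qed.

Lemma fevalZ c f : ev (c *: f) = iota c * ev f.
Proof.
rewrite (@fevalEw (msupp f)) ?msuppZ_le // mulr_sumr; apply: eq_bigr => w _.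
by rewrite mcoeffZ rmorphM mulrA.
Qed.

Lemma feval0 : ev 0 = 0.
Proof. by rewrite -(scale0r 0) fevalZ rmorph0 mul0r. Qed.

Lemma feval_sum (I : Type) (r : seq I) (P : pred I) (F : I -> {freealg K[G]}) :
  ev (\sum_(i <- r | P i) F i) = \sum_(i <- r | P i) ev (F i).
Proof. exact: (big_morph ev fevalD feval0). Qed.

Lemma feval_mon w : ev (mon K w) = \prod_(x <- w) v x.
Proof.
by rewrite monE /feval msuppU1 big_seq_fset1 mcoeffUU rmorph1 mul1r.
Qed.

Lemma feval_term c w : ev (c *: mon K w) = iota c * \prod_(x <- w) v x.
Proof. by rewrite fevalZ feval_mon. Qed.

Lemma fevalM : {morph ev : f g / f * g}.
Proof.
move=> f g; rewrite (freealg_sum f) (freealg_sum g) mulr_suml 3!feval_sum.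
rewrite mulr_suml; apply: eq_bigr => w _.
rewrite mulr_sumr feval_sum mulr_sumr; apply: eq_bigr => w' _.
rewrite -scalerAl freealg_scaleAr scalerA -mon_cat !feval_term big_cat rmorphM /=.
by rewrite -!mulrA; congr (_ * _); rewrite !mulrA iota_central.
Qed.

End Feval.

Lemma malgC_central (c : K) f : c%:MP * f = f * c%:MP.
Proof. by rewrite -[in RHS](mulr1 (c%:MP)) !mul_malgC freealg_scaleAr mulr1. Qed.

(** The universal property of the free algebra: evaluation in the free algebra
    itself is an algebra endomorphism. *)
Lemma subst_endo (sigma : var G -> {freealg K[G]}) :
  exists phi : {lrmorphism {freealg K[G]} -> {freealg K[G]}},
    forall w, phi (mon K w) = \prod_(x <- w) sigma x.
Proof.
pose ev := feval (@malgC {fmonom (var G)} K : {rmorphism _ -> _}) sigma.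
have evZ : scalable ev by move=> c f; rewrite /ev fevalZ /= mul_malgC.
have evD : zmod_morphism ev.
  by move=> f g; rewrite /ev fevalD -[- g]scaleN1r [feval _ _ (_ *: g)]evZ scaleN1r.
have evM : monoid_morphism ev.
  split; last by move=> f g; rewrite /ev (fevalM malgC_central).
  by rewrite -[X in ev X]mon_nil /ev feval_mon big_nil.
pose m1 := GRing.isZmodMorphism.Build _ _ ev evD.
pose m2 := GRing.isScalable.Build _ _ _ _ ev evZ.
pose m3 := GRing.isMonoidMorphism.Build _ _ ev evM.
pose phi : {lrmorphism {freealg K[G]} -> {freealg K[G]}} := HB.pack ev m1 m2 m3.
by exists phi => w; rewrite [LHS]feval_mon.
Qed.
End Evaluation.

(** * Eulerian trails *)

Section Trails.
Context (G : groupType).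
Implicit Types (w u v : seq (var G)) (p q : G).

(** The list of edges (letter, source) of the walk in G that starts at p and is
    driven by w; its last vertex is p * deg w. *)
Fixpoint trail p w : seq (var G * G) :=
  if w is x :: w' then (x, p) :: trail (p * alpha x)%g w' else [::].

Lemma size_trail p w : size (trail p w) = size w.
Proof. by elim: w p => //= x w IH p; rewrite IH. Qed.

Lemma trail_cat p u v : trail p (u ++ v) = trail p u ++ trail (p * deg u)%g v.
Proof.
elim: u p => [|x u IH] p; first by rewrite deg_nil mulg1.
by rewrite /= IH deg_cons mulgA.
Qed.

Lemma trail_shift q p w :
  trail (q * p)%g w = map (fun e => (e.1, q * e.2)%g) (trail p w).
Proof. by elim: w p => //= x w IH p; rewrite -mulgA IH. Qed.

Definition same_edges w w' :=
  (deg w == deg w') && perm_eq (trail 1%g w) (trail 1%g w').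

Lemma same_edges_sym : symmetric same_edges.
Proof. by move=> w w'; rewrite /same_edges eq_sym perm_sym. Qed.

Lemma same_edges_trans : transitive same_edges.
Proof.
move=> w2 w1 w3 /andP[/eqP d12 p12] /andP[/eqP d23 p23].
by rewrite /same_edges d12 d23 eqxx (perm_trans p12).
Qed.

(** Left translation of G makes the origin of the walks irrelevant. *)
Lemma perm_trail p w w' :
  perm_eq (trail p w) (trail p w') = perm_eq (trail 1%g w) (trail 1%g w').
Proof.
rewrite -{1 2}(mulg1 p) !trail_shift; apply/idP/idP; last exact: perm_map.
move/(perm_map (fun e : var G * G => (e.1, p^-1 * e.2)%g)); rewrite -!map_comp.
by rewrite !map_id_in // => -[x q] _ /=; rewrite mulgA mulVg mul1g.
Qed.

Lemma trail_closed (B : G -> Prop) p w : B p ->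
  (forall e, e \in trail p w -> B e.2 -> B (e.2 * alpha e.1)%g) ->
  forall e, e \in trail p w -> B e.2.
Proof.
elim: w p => [|x w IH] p //= Bp step e; rewrite inE => /predU1P[->//|].
apply: IH => [|e' e'w]; last by apply: step; rewrite inE e'w orbT.
by apply: (step (x, p)); rewrite ?inE ?eqxx.
Qed.

Lemma mem_trail p w e :
  reflect (exists u v, w = u ++ e.1 :: v /\ e.2 = (p * deg u)%g)
          (e \in trail p w).
Proof.
apply: (iffP idP) => [|[u [v [-> ep]]]]; last first.
  by rewrite trail_cat mem_cat /= -ep -surjective_pairing inE eqxx orbT.
elim: w p => [|x w IH] p //=; rewrite inE => /predU1P[->|/IH].
  by exists [::], w; rewrite deg_nil mulg1.
by move=> [u [v [-> ep]]]; exists (x :: u), v; rewrite deg_cons mulgA.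
Qed.

(** The trails a w and u a v from p have the same edges, and u is a non-empty closed
    walk.  If the vertices of u and those of v were disjoint, then w, which starts at
    the origin of v and uses the edges of u and v, could never leave the vertices of v
    and would miss the edges of u.  A common vertex splits u and v, and the two pieces
    u1 and a v1 lead from p to it. *)
Lemma common_vertex p a w u v : u != [::] -> (p * deg u = p)%g ->
  perm_eq (trail p (a :: w)) (trail p (u ++ a :: v)) ->
  exists u1 u2 v1 v2, [/\ u = u1 ++ u2, v = v1 ++ v2
    & deg u1 = deg (a :: v1)].
Proof.
move=> u0 pu; rewrite trail_cat pu /= perm_sym perm_catC /= perm_cons perm_catC.
rewrite perm_sym => perm; apply: contrapT => disj.
(* B is the set of vertices of v, its endpoint included. *)
pose B q := exists v1 v2, v = v1 ++ v2 /\ q = (p * alpha a * deg v1)%g.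
have notB q : B q -> q \in map snd (trail p u) -> False.
  move=> [v1 [v2 [vE qE]]] /mapP[e /mem_trail[u1 [u2 [uE eE]]] /= qe].
  apply: disj; exists u1, (e.1 :: u2), v1, v2; split=> //.
  by move: qE; rewrite qe eE -mulgA => /mulgI ->; rewrite deg_cons.
have Bstart : B (p * alpha a)%g by exists [::], v; rewrite deg_nil mulg1.
have step e : e \in trail (p * alpha a)%g w -> B e.2 -> B (e.2 * alpha e.1)%g.
  rewrite (perm_mem perm) mem_cat => /orP[eu Be|].
    by case: (notB _ Be); apply: map_f.
  case/mem_trail=> v1 [v2 [vE ->]] _; exists (rcons v1 e.1), v2; rewrite vE.
  by rewrite cat_rcons -cats1 deg_cat deg_cons deg_nil mulg1 !mulgA.
case: u u0 pu perm disj notB => // b u _ pu perm disj notB.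
apply: (notB p); last by rewrite /= inE eqxx.
by apply: (trail_closed Bstart step (e := (b, p))); rewrite (perm_mem perm) /= inE eqxx.
Qed.

Section Congruence.
Variable E : seq (var G) -> seq (var G) -> Prop.
Hypothesis E_refl : forall w, E w w.
Hypothesis E_trans : forall w1 w2 w3, E w1 w2 -> E w2 w3 -> E w1 w3.
Hypothesis E_cons : forall a w w', E w w' -> E (a :: w) (a :: w').
Hypothesis E_swap : forall u1 u2 u3 v, deg u1 = deg u3 ->
  deg u2 = ((deg u1)^-1)%g -> E (u1 ++ u2 ++ u3 ++ v) (u3 ++ u2 ++ u1 ++ v).

(** Eulerian trails with the same edges are linked by swaps.  By induction on w = a w1,
    it suffices to bring the edge a in front in w' = u a v.  Cutting u = u1 u2 and
    v = v1 v2 at a common vertex, the swap turns u1 u2 (a v1) v2 into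
    (a v1) u2 u1 v2: here u1 and a v1 have the same endpoints, and u2 closes u1. *)
Lemma trail_congr p w w' : perm_eq (trail p w) (trail p w') -> E w' w.
Proof.
elim: w p w' => [|a w IH] p w' perm.
  move/perm_size: perm; rewrite /= size_trail.
  by case: w' => //.
have : (a, p) \in trail p w' by rewrite -(perm_mem perm) inE eqxx.
case/mem_trail=> u [v [/= w'E pE]].
suff [v' Ev' perm'] : exists2 v', E w' (a :: v')
    & perm_eq (trail p w') (trail p (a :: v')).
  apply: (E_trans Ev'); apply: E_cons; apply: (IH (p * alpha a)%g).
  by have := perm_trans perm perm'; rewrite /= perm_cons.
have [u0|u0] := eqVneq u [::]; first by exists v; rewrite w'E u0 //; exact: E_refl.
have := perm; rewrite w'E => /common_vertex[] // u1 [u2 [v1 [v2 [uE vE du]]]].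
have du2 : deg u2 = ((deg u1)^-1)%g.
  move: pE; rewrite uE deg_cat -[LHS]mulg1 => /mulgI duu.
  by apply: (mulgI (deg u1)); rewrite -duu mulgV.
exists (v1 ++ u2 ++ u1 ++ v2).
  by rewrite uE vE -catA; exact: (E_swap (u3 := a :: v1)).
rewrite uE vE -!cat_cons -!catA.
rewrite !trail_cat -du du2 !mulgK.
by rewrite perm_catCA perm_sym perm_catCA perm_cat2l perm_catCA.
Qed.
End Congruence.
End Trails.

(** * Congruences modulo a graded ideal closed under substitution *)

Section IdealCongruence.
Context (G : groupType) (K : comNzRingType) (I : set {freealg K[G]}).
Hypothesis I_TG : TG_ideal I.
Implicit Types (f g : {freealg K[G]}) (u v w : seq (var G)).

Lemma TG0 : I 0. Proof. by case: I_TG. Qed.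

Lemma TGD f g : I f -> I g -> I (f + g).
Proof. by case: I_TG => _ ID _ _ _; apply: ID. Qed.

Lemma TGM a f b : I f -> I (a * f * b).
Proof.
by case: I_TG => _ _ IM _ _ If; apply: (IM _ b _).2; apply: (IM _ a _).1.
Qed.

Lemma TGZ c f : I f -> I (c *: f).
Proof. by move=> If; rewrite -mul_malgC -[_ * f]mulr1; apply: TGM. Qed.

Lemma TG_sum (J : Type) (r : seq J) (P : pred J) (F : J -> {freealg K[G]}) :
  (forall j, P j -> I (F j)) -> I (\sum_(j <- r | P j) F j).
Proof. exact: (big_ind I TG0 TGD). Qed.

(** Substitution of the i-th word of us for the variable of index i that has the same
    degree; the other variables are fixed, so that the endomorphism is graded. *)
Lemma subst_words (us : seq (seq (var G))) :
  exists phi : {lrmorphism {freealg K[G]} -> {freealg K[G]}},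
    (forall js : seq nat,
       phi (mon K (map (fun i => (deg (nth [::] us i), i)) js)) =
       mon K (flatten (map (nth [::] us) js)))
    /\ (forall f, I f -> I (phi f)).
Proof.
pose u (x : var G) := if deg (nth [::] us x.2) == x.1 then nth [::] us x.2
                      else [:: x].
have degu x : deg (u x) = alpha x.
  by rewrite /u; case: eqP => // _; rewrite deg_cons deg_nil mulg1.
have [phi phiE] := subst_endo (fun x => mon K (u x)).
exists phi; split=> [js|f If].
  rewrite phiE mon_flatten !big_map; apply: eq_bigr => i _.
  by rewrite /u eqxx.
case: I_TG => _ _ _ _; apply=> // g a [s [sg ->]].
exists [seq (p.1, flatten (map u p.2)) | p <- s]; split=> [p /mapP[q qs ->] /=|].
  rewrite -(sg q qs); elim: (q.2) => [|x w IH] /=; first by [].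
  by rewrite deg_cat deg_cons IH degu.
rewrite linear_sum big_map; apply: eq_bigr => p _ /=.
rewrite linearZ /= phiE; congr (_ *: _).
by elim: (p.2) => [|x w IH]; rewrite ?big_nil ?mon_nil // big_cons IH -mon_cat.
Qed.

Definition congr_mod w w' := I (mon K w - mon K w').

Lemma congr_refl w : congr_mod w w.
Proof. by rewrite /congr_mod subrr; apply: TG0. Qed.

Lemma congr_trans w1 w2 w3 :
  congr_mod w1 w2 -> congr_mod w2 w3 -> congr_mod w1 w3.
Proof. by move=> h12 h23; have := TGD h12 h23; rewrite addrA subrK. Qed.

Lemma congr_cat u v w w' :
  congr_mod w w' -> congr_mod (u ++ w ++ v) (u ++ w' ++ v).
Proof.
move=> /(TGM (mon K u) (mon K v)).
by rewrite /congr_mod (mulrBr (mon K u)) (mulrBl (mon K v)) 2!mon_cat3.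
Qed.

Lemma congr_cons a w w' : congr_mod w w' -> congr_mod (a :: w) (a :: w').
Proof. by move/(congr_cat [:: a] [::]); rewrite !cats0. Qed.

Hypothesis I_gen1 : @gen1 G K `<=` I.
Hypothesis I_gen2 : @gen2 G K `<=` I.

Lemma congr_comm u v : deg u = 1%g -> deg v = 1%g -> congr_mod (u ++ v) (v ++ u).
Proof.
move=> du dv; have [phi [phiE phiI]] := subst_words [:: u; v].
have /phiI : I (mon K [:: (deg u, 0%N); (deg v, 1%N)]
             - mon K [:: (deg v, 1%N); (deg u, 0%N)]).
  by rewrite 2!mon2; apply: I_gen1; exists (deg u, 0%N), (deg v, 1%N).
have := phiE [:: 0%N; 1%N]; have := phiE [:: 1%N; 0%N].
by rewrite raddfB /= !cats0 /congr_mod => -> ->.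
Qed.

(** When the degrees are trivial, relation (2) is replaced by two uses of (1). *)
Lemma congr_swap u1 u2 u3 : deg u1 = deg u3 -> deg u2 = ((deg u1)^-1)%g ->
  congr_mod (u1 ++ u2 ++ u3) (u3 ++ u2 ++ u1).
Proof.
move=> du1 du2; have [d1|d1] := eqVneq (deg u1) 1%g.
  have d2 : deg u2 = 1%g by rewrite du2 d1 invg1.
  have d3 : deg u3 = 1%g by rewrite -du1.
  apply: (@congr_trans _ (u2 ++ u3 ++ u1)).
    by rewrite [X in congr_mod _ X]catA; apply: congr_comm; rewrite // deg_cat d2 d3 mulg1.
  have := congr_cat [::] u1 (congr_comm d2 d3).
  by rewrite /= -!catA.
have [phi [phiE phiI]] := subst_words [:: u1; u2; u3].
have /phiI : I (mon K [:: (deg u1, 0%N); (deg u2, 1%N); (deg u3, 2%N)]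
             - mon K [:: (deg u3, 2%N); (deg u2, 1%N); (deg u1, 0%N)]).
  rewrite 2!mon3; apply: I_gen2.
  exists (deg u1, 0%N), (deg u2, 1%N), (deg u3, 2%N).
  by rewrite /alpha /= du2 invgK; split=> //; apply/eqP.
have := phiE [:: 0%N; 1%N; 2%N]; have := phiE [:: 2%N; 1%N; 0%N].
by rewrite raddfB /= !cats0 /congr_mod => -> ->.
Qed.

Lemma same_edges_congr w w' : same_edges w w' -> congr_mod w w'.
Proof.
move=> /andP[_ perm]; rewrite perm_sym in perm; move: perm.
apply: trail_congr; [exact: congr_refl|exact: congr_trans|exact: congr_cons|].
move=> u1 u2 u3 v du1 du2; have := congr_cat [::] v (congr_swap du1 du2).
by rewrite /= -!catA.
Qed.

(** Modulo I, each word may be replaced by a representative of its class, so a class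
    of words contributes its coefficient sum times the representative: it dies either
    because that sum is 0 or because the representative lies in I. *)
Lemma sum_mod_same_edges (D : pred (seq (var G)))
    (L : seq (K * seq (var G))) :
  (forall w, D w -> I (mon K w)) ->
  (forall w, ~~ D w -> \sum_(p <- L | same_edges p.2 w) p.1 = 0) ->
  I (\sum_(p <- L) p.1 *: mon K p.2).
Proof.
move=> ID; have [m] := ubnP (size L); elim: m L => // m IH [|[c w] L] /= sL sum0.
  by rewrite big_nil; apply: TG0.
set L0 := (c, w) :: L; rewrite -/L0 in sum0.
rewrite -/L0 (bigID (fun p => same_edges p.2 w)) /=; apply: TGD; last first.
  rewrite -big_filter; apply: IH => [|w' Dw'].
    rewrite /L0 /= /same_edges eqxx perm_refl /=.
    by rewrite size_filter (leq_ltn_trans (count_size _ _)).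
  rewrite big_filter_cond; have [ww'|Nww'] := boolP (same_edges w w').
    rewrite big_pred0 // => p; apply/negbTE; rewrite negb_and negbK.
    have [pw'|] := boolP (same_edges p.2 w'); last by rewrite orbT.
    by rewrite (same_edges_trans pw') // same_edges_sym.
  rewrite -[RHS](sum0 _ Dw'); apply: eq_bigl => p.
  apply: andb_idl => pw'; apply: contra Nww' => pw.
  by apply: same_edges_trans pw'; rewrite same_edges_sym.
have [Dw|Dw] := boolP (D w).
  apply: TG_sum => p /same_edges_congr /TGD /(_ (ID _ Dw)).
  by rewrite subrK; apply: TGZ.
rewrite (eq_bigr (fun p => p.1 *: (mon K p.2 - mon K w) + p.1 *: mon K w)).
  rewrite big_split /= -scaler_suml sum0 // scale0r addr0.
  by apply: TG_sum => p /same_edges_congr; apply: TGZ.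
by move=> p _; rewrite -scalerDr subrK.
Qed.
End IdealCongruence.

(** * Walks and homogeneous matrices *)

Section Walks.
Context (G : groupType) (n : nat) (gs : 'I_n -> G).
Hypothesis gs_inj : injective gs.
Implicit Types (w : seq (var G)) (p q : G) (hs : seq G).

Definition inS p := [exists j, gs j == p].

Lemma inS_gs k : inS (gs k).
Proof. by apply/existsP; exists k. Qed.

Fixpoint walk p hs :=
  inS p && (if hs is h :: hs' then walk (p * h)%g hs' else true).

Lemma walkP p hs :
  reflect (forall i, inS (p * \prod_(h <- take i hs) h)%g) (walk p hs).
Proof.
elim: hs p => [|h hs IH] p /=.
  rewrite andbT; apply: (iffP idP) => [pS i|/(_ 0%N)]; rewrite ?take_nil.
    by rewrite big_nil mulg1.
  by rewrite big_nil mulg1.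
apply: (iffP andP) => [[pS /IH hsS] [|i]|pS].
- by rewrite big_nil mulg1.
- by rewrite big_cons mulgA.
split; first by move: (pS 0%N); rewrite big_nil mulg1.
by apply/IH => i; move: (pS i.+1); rewrite big_cons mulgA.
Qed.

Lemma walk_trail p w : walk p (map (@alpha G) w) =
  all (fun e => inS e.2) (trail p w) && inS (p * deg w)%g.
Proof.
elim: w p => [|x w IH] p /=; first by rewrite deg_nil mulg1 andbT.
by rewrite IH deg_cons mulgA andbA.
Qed.

Lemma walk_same_edges p w w' : same_edges w w' ->
  walk p (map (@alpha G) w) = walk p (map (@alpha G) w').
Proof.
case/andP=> /eqP dw perm; rewrite !walk_trail dw; congr andb.
by apply: perm_all; rewrite perm_trail.
Qed.

Definition dead hs := [forall k, ~~ walk (gs k) hs].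

Section PathMatrix.
Context (S : comNzRingType).

(** The general homogeneous matrix of degree alpha x.  Since gs is injective, its
    non-zero entries are labelled by edges of the walk graph. *)
Definition path_mx (y : var G * G -> S) (x : var G) : 'M[S]_n :=
  \matrix_(k, l) if gs l == (gs k * alpha x)%g then y (x, gs k) else 0.

(** Each row of path_mx has at most one non-zero entry, so a single walk from k
    contributes to the row k of a product. *)
Lemma path_mx_prod (y : var G * G -> S) w k l :
  (\prod_(x <- w) path_mx y x) k l =
  if walk (gs k) (map (@alpha G) w) && (gs l == gs k * deg w)%g
  then \prod_(e <- trail (gs k) w) y e else 0.
Proof.
elim: w k => [|x w IH] k.
  rewrite !big_nil deg_nil mulg1 (inj_eq gs_inj) /= inS_gs /=.
  by rewrite mxE eq_sym; case: eqP.
rewrite big_cons mxE /= inS_gs /= deg_cons mulgA.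
have [/existsP[j /eqP gj]|NS] := boolP (inS (gs k * alpha x)%g); last first.
  rewrite big1 => [|j _].
    by case: w {IH} => [|a w] /=; rewrite (negbTE NS).
  rewrite mxE; case: eqP => [gj|]; last by rewrite mul0r.
  by case/negP: NS; rewrite -gj inS_gs.
rewrite (bigD1 j) //= [X in _ + X]big1 ?addr0 => [|i Nij].
  rewrite mxE gj eqxx IH gj; case: ifP => _; last by rewrite mulr0.
  by rewrite big_cons.
by rewrite mxE -gj (inj_eq gs_inj) (negbTE Nij) mul0r.
Qed.

Lemma path_mx_comp y x : elem_comp gs S (alpha x) (path_mx y x).
Proof.
move=> k l; rewrite mxE; case: (gs l =P _) => [-> _|]; last by rewrite eqxx.
by rewrite mulgA mulVg mul1g.
Qed.

Lemma elem_compP (v : var G -> 'M[S]_n) :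
  (forall x, elem_comp gs S (alpha x) (v x)) -> exists y, v = path_mx y.
Proof.
move=> vh; pose y (e : var G * G) : S :=
  if [pick kl | (gs kl.1 == e.2) && (gs kl.2 == e.2 * alpha e.1)%g] is Some kl
  then v e.1 kl.1 kl.2 else 0.
exists y; apply/funext => x; apply/matrixP => k l; rewrite mxE /y.
case: eqP => [gl|gl] /=; last first.
  apply: contrapT => /eqP /vh h; apply: gl.
  by rewrite -h mulgA mulgV mul1g.
case: pickP => [[k' l']/= /andP[/eqP /gs_inj -> /eqP]|/(_ (k, l))] /=.
  by rewrite -gl => /gs_inj ->.
by rewrite eqxx gl eqxx.
Qed.
End PathMatrix.
End Walks.

Section Soundness.
Context (G : groupType) (n : nat) (gs : 'I_n -> G).
Hypothesis gs_inj : injective gs.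
Context (K S : comNzRingType) (iota : {rmorphism K -> 'M[S]_n}).
Hypothesis iota_central : forall c a, iota c * a = a * iota c.
Hypothesis iota_diag : forall c i j, i != j -> iota c i j = 0.
Local Notation T := (TG iota (elem_comp gs S)).

Lemma feval_off_degree (v : var G -> 'M[S]_n) c w k l :
  (forall x, elem_comp gs S (alpha x) (v x)) -> gs l != (gs k * deg w)%g ->
  feval iota v (c *: mon K w) k l = 0.
Proof.
move=> /(elem_compP gs_inj) [y ->] Ndeg.
rewrite fevalZ feval_mon // mxE (bigD1 k) //= [X in _ + X]big1 ?addr0.
  by rewrite path_mx_prod // (negbTE Ndeg) andbF mulr0.
by move=> j jk; rewrite iota_diag ?mul0r // eq_sym.
Qed.

Lemma feval_free_comp (v : var G -> 'M[S]_n) g f :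
  (forall x, elem_comp gs S (alpha x) (v x)) ->
  free_comp G K g f -> elem_comp gs S g (feval iota v f).
Proof.
move=> vh [s [sg ->]] k l kl.
have [gl|Ngl] := eqVneq (gs l) (gs k * g)%g; first by rewrite gl mulgA mulVg mul1g.
case/eqP: kl; rewrite feval_sum summxE big_seq big1 // => p ps.
by rewrite feval_off_degree // sg.
Qed.

(** The component of degree g of f accounts for the entries (k, l) of the value of f
    with gs l = gs k * g, and all its other entries are 0. *)
Lemma TG_graded : graded_subset (free_comp G K) T.
Proof.
move=> f Tf; pose gr := undup (map (fun w : {fmonom (var G)} => deg w) (msupp f)).
pose part g := \sum_(w <- msupp f | deg w == g) f@_w *: mon K w.
have fE : f = \sum_(g <- gr) part g.
  rewrite /part; under eq_bigr => g _ do rewrite big_mkcond.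
  rewrite exchange_big /= {1}[f]freealg_sum big_seq [RHS]big_seq.
  apply: eq_bigr => w wf; have dw : deg w \in gr.
    by rewrite mem_undup (map_f (fun w : {fmonom (var G)} => deg w)).
  rewrite (bigD1_seq _ dw) ?undup_uniq //= eqxx big1 ?addr0 // => g gw.
  by rewrite eq_sym (negbTE gw).
exists (map part gr); split; last by rewrite big_map.
move=> _ /mapP[g _ ->]; split=> [v vh|]; last first.
  exists g, (map (fun w : {fmonom (var G)} => (f@_w, w : seq (var G)))
    (filter (fun w : {fmonom (var G)} => deg w == g) (msupp f))); split.
    by move=> p /mapP[w]; rewrite mem_filter => /andP[/eqP dw _] ->.
  by rewrite big_map big_filter.
apply/matrixP => k l; have := congr1 (fun M : 'M_n => M k l) (Tf v vh).
rewrite {1}(freealg_sum f) !feval_sum !summxE !mxE.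
have [gl fkl|Ngl _] := eqVneq (gs l) (gs k * g)%g; last first.
  by rewrite big1 // => w /eqP dw; rewrite feval_off_degree // dw.
rewrite -[RHS]fkl [LHS]big_mkcond; apply: eq_bigr => w _.
case: ifPn => // dw; rewrite feval_off_degree // gl (inj_eq (mulgI _)).
by rewrite eq_sym.
Qed.

Lemma TG_ideal_elem_comp : TG_ideal T.
Proof.
split.
- by move=> v _; exact: feval0.
- by move=> a b Ta Tb v vh; rewrite fevalD Ta // Tb // addr0.
- by move=> a b Ta; split=> v vh; rewrite fevalM // Ta // (mul0r, mulr0).
- exact: TG_graded.
move=> phi phi_gr f Tf v vh; pose v' x := feval iota v (phi (X_ K x)).
have -> : feval iota v (phi f) = feval iota v' f.
  rewrite [in LHS](freealg_sum f) [in RHS](freealg_sum f) linear_sum !feval_sum.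
  apply: eq_bigr => w _; rewrite linearZ /= !fevalZ feval_mon; congr (_ * _).
  rewrite rmorph_prod; elim: (w : seq _) => [|x u IH].
    by rewrite !big_nil -mon_nil feval_mon big_nil.
  by rewrite !big_cons fevalM // IH.
apply: Tf => x; apply: feval_free_comp => //; apply: phi_gr.
exists [:: (1, [:: x])]; split=> [p|]; last by rewrite big_seq1 scale1r mon1.
by rewrite inE => /eqP->; rewrite deg_cons deg_nil mulg1.
Qed.

(** The edges of a walk determine whether it stays inside, and the term that it
    contributes; relations (1) and (2) compare words with the same edges. *)
Lemma same_edges_TG w w' : same_edges w w' -> T (mon K w - mon K w').
Proof.
move=> ww' v /(elem_compP gs_inj) [y ->].
rewrite fevalD -scaleN1r fevalZ rmorphN1 mulN1r !feval_mon; apply/matrixP => k l.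
rewrite !mxE !path_mx_prod // (walk_same_edges gs _ ww').
case/andP: ww' => /eqP dw perm; rewrite dw; case: ifP => _; last by rewrite subrr.
by rewrite (perm_big (trail (gs k) w')) ?subrr // perm_trail.
Qed.

Lemma dead_TG w : dead gs (map (@alpha G) w) -> T (mon K w).
Proof.
move=> /forallP dw v /(elem_compP gs_inj) [y ->]; rewrite feval_mon.
by apply/matrixP => k l; rewrite path_mx_prod // (negbTE (dw k)) mxE.
Qed.

Lemma gen1_TG : @gen1 G K `<=` T.
Proof.
move=> _ [x1 [x2 [d1 d2 ->]]].
suff : T (mon K [:: x1; x2] - mon K [:: x2; x1]) by rewrite 2!mon2.
apply: same_edges_TG.
rewrite /same_edges /= !deg_cons !deg_nil d1 d2 !mulg1 eqxx.
by apply/permP => P /=; rewrite !addn0 addnC.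
Qed.

Lemma gen2_TG : @gen2 G K `<=` T.
Proof.
move=> _ [x1 [x2 [x3 [d1 d3 _ ->]]]].
suff : T (mon K [:: x1; x2; x3] - mon K [:: x3; x2; x1]) by rewrite 2!mon3.
apply: same_edges_TG.
rewrite /same_edges /= !deg_cons !deg_nil d1 d3 !mulg1 !mul1g mulVg eqxx /=.
by apply/permP => P /=; rewrite !addn0 addnC -addnA addnCA addnA addnC addnA.
Qed.
End Soundness.

(** * Linear independence of monomials and completeness *)

Lemma malgUM (M : monomType) (R : comNzRingType) (m m' : M) :
  << m >> * << m' >> = << mmul m m' >> :> {malg R[M]}.
Proof. by rewrite malgM_def fgmulUU mulr1. Qed.

Section PolynomialMonomials.
Context (T : choiceType) (K : comNzRingType).
Local Notation P := {malg K[{cmonom T}]}.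

Definition cmon (s : seq T) : {cmonom T} := \big[mmul/mone]_(t <- s) ucm t.

Lemma cmon_count s t : cmon s t = count_mem t s.
Proof.
rewrite /cmon; elim: s => [|e s IH]; first by rewrite big_nil cm1.
by rewrite big_cons cmM IH cmU.
Qed.

Lemma prod_ucm s : \prod_(t <- s) (<< ucm t >> : P) = << cmon s >>.
Proof.
elim: s => [|t s IH]; first by rewrite big_nil /cmon big_nil.
rewrite big_cons IH /cmon big_cons. exact: malgUM.
Qed.

Lemma mcoeff_monomials (L : seq (K * seq T)) s :
  (\sum_(p <- L) (p.1%:MP : P) * \prod_(t <- p.2) << ucm t >>)@_(cmon s)
  = \sum_(p <- L | perm_eq p.2 s) p.1.
Proof.
rewrite raddf_sum [RHS]big_mkcond; apply: eq_bigr => p _ /=.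
rewrite prod_ucm mul_malgC mcoeffZ mcoeffU1.
have -> : (cmon p.2 == cmon s) = perm_eq p.2 s.
  apply/cmP/idP => [ps|/permP ps t]; last by rewrite !cmon_count.
  by rewrite /perm_eq; apply/allP => t _; apply/eqP; rewrite -!cmon_count.
by case: ifP; rewrite ?mulr1 ?mulr0.
Qed.
End PolynomialMonomials.

Section Completeness.
Context (G : groupType) (n : nat) (gs : 'I_n -> G).
Hypothesis gs_inj : injective gs.
Context (K S : comNzRingType) (rho : {rmorphism K -> S}).
Context (iota : {rmorphism K -> 'M[S]_n}).
Hypothesis iotaE : forall c, iota c = (rho c)%:M.

Lemma iota_central c a : iota c * a = a * iota c.
Proof. by rewrite iotaE; apply: esym; exact: scalar_mxC. Qed.

Lemma iota_diag c i j : i != j -> iota c i j = 0.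
Proof. by rewrite iotaE mxE => /negbTE ->. Qed.

Lemma iota_entry c (M : 'M[S]_n) k l : (iota c * M) k l = rho c * M k l.
Proof. by rewrite iotaE -[_ * M]/(_ *m M) mul_scalar_mx mxE. Qed.

(** The monomials in the edge labels, evaluated along the labellings of Y, are linearly
    independent over K.  Monomials are sequences of edges up to permutation. *)
Definition separating (Y : set (var G * G -> S)) :=
  forall L : seq (K * seq (var G * G)),
    (forall p, p \in L -> all (fun e => inS gs e.2) p.2) ->
    (forall y, Y y -> \sum_(p <- L) rho p.1 * \prod_(e <- p.2) y e = 0) ->
  forall s, all (fun e => inS gs e.2) s ->
    \sum_(p <- L | perm_eq p.2 s) p.1 = 0.

(** Look at the entry (k, l), where the walk of w0 leads from row k to row l inside:
    the words that contribute to it the monomial of w0 are exactly those with the same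
    edges as w0. *)
Lemma class_sum_eq0 Y f w0 : separating Y ->
  (forall y, Y y -> feval iota (path_mx gs y) f = 0) ->
  ~~ dead gs (map (@alpha G) w0) ->
  \sum_(w <- msupp f | same_edges w w0) f@_w = 0.
Proof.
move=> sepY fY; rewrite negb_forall => /existsP[k]; rewrite negbK => walk0.
have := walk0; rewrite walk_trail => /andP[tr0 /existsP[l /eqP gl]].
pose reach w := walk gs (gs k) (map (@alpha G) w) && (gs l == gs k * deg w)%g.
pose L := [seq (f@_w, trail (gs k) w) |
             w <- [seq w : {fmonom (var G)} <- msupp f | reach w]].
have Lin p : p \in L -> all (fun e => inS gs e.2) p.2.
  case/mapP=> w; rewrite mem_filter => /andP[/andP[+ _] _] -> /=.
  by rewrite walk_trail => /andP[].
have L0 y : Y y -> \sum_(p <- L) rho p.1 * \prod_(e <- p.2) y e = 0.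
  move=> /fY /(congr1 (fun M : 'M_n => M k l)).
  rewrite {1}(freealg_sum f) feval_sum summxE mxE => f0.
  rewrite big_map big_filter big_mkcond -[RHS]f0; apply: eq_bigr => w _.
  rewrite fevalZ iota_entry feval_mon path_mx_prod // -/(reach w).
  by case: ifP; rewrite ?mulr0.
rewrite -[RHS](sepY L Lin L0 _ tr0) big_map big_filter_cond.
apply: eq_bigl => w; rewrite /= perm_trail; apply/idP/andP => [ww0|[]].
  have /andP[/eqP dw pw] := ww0.
  by rewrite /reach (walk_same_edges _ _ ww0) walk0 gl dw eqxx.
case/andP=> _; rewrite gl (inj_eq (mulgI _)) /same_edges => /eqP -> ->.
by rewrite eqxx.
Qed.

Lemma completeness Y f (I : set {freealg K[G]}) : separating Y ->
  (forall y, Y y -> feval iota (path_mx gs y) f = 0) ->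
  TG_ideal I -> @gen1 G K `<=` I -> @gen2 G K `<=` I ->
  (forall w, dead gs (map (@alpha G) w) -> I (mon K w)) -> I f.
Proof.
move=> sepY fY ITG I1 I2 Idead; rewrite [f]freealg_sum.
pose L := [seq (f@_w, w : seq (var G)) | w : {fmonom (var G)} <- msupp f].
have -> : \sum_(w <- msupp f) f@_w *: mon K w = \sum_(p <- L) p.1 *: mon K p.2.
  by rewrite big_map.
apply: (sum_mod_same_edges ITG I1 I2 Idead) => w Nw.
by rewrite big_map; apply: class_sum_eq0 fY _.
Qed.

End Completeness.

Section Generic.
Context (G : groupType) (n : nat) (gs : 'I_n -> G) (K : comNzRingType).
Hypothesis gs_inj : injective gs.
Variable k0 : 'I_n.
Local Notation O := (Omega G n K).

(** Edges name their source by a group element, the variables of Omega by a row index;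
    the default k0 is only reached outside the range of gs. *)
Definition row_of (p : G) : 'I_n := odflt k0 [pick k | gs k == p].

Lemma row_of_gs k : row_of (gs k) = k.
Proof.
rewrite /row_of; case: pickP => [k' /eqP /gs_inj //|/(_ k)].
by rewrite eqxx.
Qed.

Lemma gs_row_of p : inS gs p -> gs (row_of p) = p.
Proof. by case/existsP=> k /eqP <-; rewrite row_of_gs. Qed.

Definition edge_var (e : var G * G) : G * nat * 'I_n := (e.1.1, e.1.2, row_of e.2).

Definition y_gen (e : var G * G) : O := y_ K e.1.1 e.1.2 (row_of e.2).

Lemma path_mx_gen (x : var G) : path_mx gs y_gen x = gen_mx gs K x.1 x.2.
Proof.
apply/matrixP => k l; rewrite mxE /gen_mx summxE (bigD1 k) //= [X in _ + X]big1 ?addr0.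
  rewrite summxE big_mkcond (bigD1 l) //= [X in _ + X]big1 ?addr0.
    by case: ifP => // _; rewrite !mxE !eqxx mulr1 /y_gen /= row_of_gs.
  move=> j /negbTE jl; case: ifP => // _.
  by rewrite !mxE [l == j]eq_sym jl andbF mulr0.
move=> k' /negbTE kk'; rewrite summxE big1 // => j _.
by rewrite !mxE [k == k']eq_sym kk' mulr0.
Qed.

Lemma separating_gen :
  separating gs (@mkmalgU {cmonom (G * nat * 'I_n)%type} K mone) [set y_gen].
Proof.
pose back (t : G * nat * 'I_n) : var G * G := (t.1, gs t.2).
have edge_varK s : all (fun e => inS gs e.2) s -> map back (map edge_var s) = s.
  move/allP => sS; rewrite -map_comp map_id_in // => -[[h i] p] /sS /= pS.
  by rewrite /back /= gs_row_of.
move=> L LS /(_ _ erefl) L0 s sS.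
pose L' := [seq (p.1, map edge_var p.2) | p <- L].
have := mcoeff_monomials L' (map edge_var s).
pose Poly := {malg K[{cmonom (G * nat * 'I_n)%type}]}.
have {}L0 : \sum_(p <- L) (p.1%:MP : Poly)
    * \prod_(e <- p.2) << ucm (edge_var e) >> = 0 by exact: L0.
rewrite big_map; under eq_bigr => p _ do rewrite big_map.
rewrite L0.
rewrite mcoeff0 big_map => L'0; rewrite [RHS]L'0 big_seq_cond [RHS]big_seq_cond.
apply: eq_bigl => p; apply: andb_id2l => /LS pS.
apply/idP/idP => [|perm]; first exact: perm_map.
by rewrite -(edge_varK _ pS) -(edge_varK _ sS); apply: perm_map.
Qed.
End Generic.

(** * Support and identities of the generic matrices *)

Section GenericTG.
Context (G : groupType) (n : nat) (gs : 'I_n -> G) (K : comNzRingType).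
Hypothesis gs_inj : injective gs.
Variable k0 : 'I_n.

Lemma gen_mx_R h i : R_comp gs K h (gen_mx gs K h i).
Proof.
split; first by apply: (sub_smallest (@subset_refl _ _)); exists h, i.
rewrite -(path_mx_gen K gs_inj k0 (h, i)).
exact: (@path_mx_comp _ _ gs _ (y_gen gs K k0) (h, i)).
Qed.

Lemma Supp_RP h : Supp (R_comp gs K) h <-> exists k l, gs l = (gs k * h)%g.
Proof.
split=> [[A [_ Ah] /eqP An0]|[k [l gl]]].
  apply: contrapT => noh; apply: An0; apply/matrixP => k l; rewrite mxE.
  apply: contrapT => /eqP /Ah gkl; apply: noh; exists k, l.
  by rewrite -gkl mulgA mulgV mul1g.
exists (gen_mx gs K h 0%N); first exact: gen_mx_R.
apply/eqP => /matrixP/(_ k l)/eqP.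
rewrite -(path_mx_gen K gs_inj k0 (h, 0%N)) !mxE gl eqxx; apply/negP.
by rewrite monalgU_eq0 oner_eq0.
Qed.

Lemma Supp_R1 : Supp (R_comp gs K) 1%g.
Proof. by apply/Supp_RP; exists k0, k0; rewrite mulg1. Qed.

Lemma R_comp_eq0 h : R_comp gs K h = [set 0] <-> ~ Supp (R_comp gs K) h.
Proof.
split=> [Rh0 [A]|NSh]; first by rewrite Rh0 => -> /eqP.
have h0 : R_comp gs K h `<=` [set 0].
  by move=> A RA; apply: contrapT => /eqP A0; apply: NSh; exists A.
by apply/seteqP; split=> // _ ->; have := gen_mx_R h 0; rewrite (h0 _ (gen_mx_R h 0)).
Qed.

Lemma feval_gen_eq0 f : TG (iotaOmega G n K) (R_comp gs K) f ->
  feval (iotaOmega G n K) (path_mx gs (y_gen gs K k0)) f = 0.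
Proof.
by apply=> x; rewrite (path_mx_gen K gs_inj); exact: gen_mx_R.
Qed.

(** If w were not dead, its class would have coefficient sum 1. *)
Lemma TG_mon_dead w : TG (iotaOmega G n K) (R_comp gs K) (mon K w) ->
  dead gs (map (@alpha G) w).
Proof.
move=> /feval_gen_eq0 w0; apply: contrapT => /negP Ndead.
have wY y : [set y_gen gs K k0] y ->
    feval (iotaOmega G n K) (path_mx gs y) (mon K w) = 0 by move=> ->.
have := class_sum_eq0 gs_inj (iota := iotaOmega G n K) (fun=> erefl)
  (@separating_gen _ _ _ K gs_inj k0) wY Ndead.
rewrite monE msuppU1 big_mkcond big_seq_fset1 mcoeffUU /same_edges eqxx perm_refl.
by move/eqP; rewrite oner_eq0.
Qed.

Section Soundness34.
Context (S : comNzRingType) (iota : {rmorphism K -> 'M[S]_n}).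

Lemma gen3_TG : @gen3 G n gs K `<=` TG iota (elem_comp gs S).
Proof.
move=> _ [x /R_comp_eq0 Nx ->] v /(elem_compP gs_inj) [y ->].
rewrite -mon1 feval_mon big_seq1; apply/matrixP => k l; rewrite !mxE.
by case: eqP => // gl; case: Nx; apply/Supp_RP; exists k, l.
Qed.

Lemma gen4_TG : @gen4 G n gs K `<=` TG iota (elem_comp gs S).
Proof. by move=> _ [w [_ /TG_mon_dead wdead _ ->]]; apply: dead_TG. Qed.
End Soundness34.
End GenericTG.

(** * Reduction of dead words *)

Section DeadWords.
Context (G : groupType) (n : nat) (gs : 'I_n -> G) (K : comNzRingType).
Hypothesis gs_inj : injective gs.
Variable k0 : 'I_n.

Lemma deg_flatten (us : seq (seq (var G))) :
  deg (flatten us) = (\prod_(h <- map (@deg G) us) h)%g.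
Proof.
elim: us => [|u us IH]; first by rewrite deg_nil big_nil.
by rewrite deg_cat IH big_cons.
Qed.

(** The vertex between the steps h and h' is already visited after i steps, so skipping
    it does not change the set of visited vertices. *)
Lemma walk_merge p A h h' B i : (i <= size A)%N ->
  (\prod_(g <- take i A) g = (\prod_(g <- A) g) * h)%g ->
  walk gs p (A ++ (h * h')%g :: B) -> walk gs p (A ++ h :: h' :: B).
Proof.
move=> iA Ai /walkP pS; apply/walkP => j.
have [jA|] := leqP j (size A).
  by have := pS j; rewrite !takel_cat.
move=> /subnKC; set m := (j - _)%N => <-; rewrite addSnnS take_cat.
rewrite ltnNge leq_addr addKn /=; case: m => [|m].
  by rewrite take0 big_cat big_seq1 /= -Ai; have := pS i; rewrite takel_cat.
have := pS (size A + m.+1)%N; rewrite take_cat ltnNge leq_addr addKn /=.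
by rewrite !big_cat !big_cons !mulgA.
Qed.

Lemma dead_merge a u v b i : (i <= size a)%N ->
  deg (flatten (take i a)) = deg (flatten a ++ u) ->
  dead gs (map (@deg G) (a ++ u :: v :: b)) ->
  dead gs (map (@deg G) (a ++ (u ++ v) :: b)).
Proof.
move=> ia; rewrite deg_cat !deg_flatten => Pi /forallP us_dead.
apply/forallP => k; apply: contra (us_dead k).
rewrite !map_cat /= deg_cat; apply: (@walk_merge _ _ _ _ _ i).
  by rewrite size_map.
by rewrite -map_take.
Qed.

(** The multilinear word from which the concatenation of us is obtained by
    substitution: its i-th variable has index i and the degree of the i-th block. *)
Definition fresh (us : seq (seq (var G))) : seq (var G) :=
  mkseq (fun i => (deg (nth [::] us i), i)) (size us).

Lemma alpha_fresh us : map (@alpha G) (fresh us) = map (@deg G) us.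
Proof.
by rewrite /fresh -[in RHS](mkseq_nth [::] us) -!map_comp.
Qed.

Lemma uniq_fresh us : uniq (fresh us).
Proof. by apply: mkseq_uniq => i j []. Qed.

Variable I : set {freealg K[G]}.
Hypothesis I_TG : TG_ideal I.

Lemma flatten_fresh us : I (mon K (fresh us)) -> I (mon K (flatten us)).
Proof.
have [phi [phiE phiI]] := subst_words I_TG us.
have -> : mon K (flatten us) = phi (mon K (fresh us)); last exact: phiI.
by rewrite /fresh /mkseq phiE; congr (mon K (flatten _)); rewrite -[LHS](mkseq_nth [::]).
Qed.

Hypothesis I_gen3 : @gen3 G n gs K `<=` I.
Hypothesis I_gen4 : @gen4 G n gs K `<=` I.

Lemma mon_off_support u : ~ Supp (R_comp gs K) (deg u) -> I (mon K u).
Proof.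
move=> Nu; have [phi [phiE phiI]] := subst_words I_TG [:: u].
have <- : phi (mon K [:: (deg u, 0%N)]) = mon K u.
  by have := phiE [:: 0%N]; rewrite /= cats0.
apply: phiI; rewrite mon1; apply: I_gen3; exists (deg u, 0%N) => //.
exact/(R_comp_eq0 K gs_inj k0).
Qed.

Lemma off_support_block us : ~ type1 gs K (fresh us) -> I (mon K (flatten us)).
Proof.
move=> Nt1; have [v [/infixP[p [q pvq]] Nv]] : exists v,
    infix v (fresh us) /\ ~ Supp (R_comp gs K) (deg v).
  apply: contrapT => noV; apply: Nt1 => v vus _.
  by apply: contrapT => Nv; apply: noV; exists v.
pose a := size p; pose b := size v.
pose u1 := take a us; pose u2 := take b (drop a us); pose u3 := drop b (drop a us).
have -> : us = u1 ++ u2 ++ u3 by rewrite !cat_take_drop.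
rewrite !flatten_cat !mon_cat mulrA; apply: TGM => //; apply: mon_off_support.
suff -> : deg (flatten u2) = deg v by [].
rewrite deg_flatten degE map_take map_drop -alpha_fresh pvq !map_cat.
by rewrite drop_size_cat ?size_map // take_size_cat ?size_map.
Qed.

Lemma s_card_lambda : (s_card gs K <= lambda gs K)%N.
Proof.
by rewrite /lambda (leq_trans (leq_addr 1 _)) // leq_pmulr // addn1.
Qed.

(** All prefixes of a Type 1-monomial, the empty one included, have their degree in
    the support, which has s elements: the pigeonhole principle applies to the proper
    prefixes as soon as there are more than s blocks. *)
Lemma type1_repeat us : type1 gs K (fresh us) -> (s_card gs K < size us)%N ->
  exists i j, [/\ (i < j)%N, (j < size us)%N
    & deg (flatten (take i us)) = deg (flatten (take j us))].
Proof.
move=> t1; pose P i := deg (flatten (take i us)).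
have PS i : Supp (R_comp gs K) (P i).
  have -> : P i = deg (take i (fresh us)).
    by rewrite /P deg_flatten degE !map_take alpha_fresh.
  have [->|ne] := eqVneq (take i (fresh us)) [::].
    by rewrite deg_nil; apply: (Supp_R1 K gs_inj k0).
  by apply: t1 => //; apply: prefixW; apply: prefix_take.
rewrite ltnNge => Nsz; have : ~~ uniq (mkseq P (size us)).
  apply: contra Nsz => Pu; rewrite -(size_mkseq P (size us)).
  apply: uniq_leq_size => // _ /mapP[i _ ->].
  by rewrite in_fset_set; [rewrite inE; exact: PS|exact: finite_Supp_R].
case/(uniqPn 1%g)=> i [j [ij jus]]; rewrite size_mkseq in jus *.
by rewrite !nth_mkseq // ?(ltn_trans ij) // => Pij; exists i, j.
Qed.

(** Induction on the number of blocks, a repeated position being removed at each step;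
    a Type 1-monomial with at most s blocks is a substitution instance of (4). *)
Lemma dead_flatten us : dead gs (map (@deg G) us) -> I (mon K (flatten us)).
Proof.
have [m] := ubnP (size us); elim: m us => // m IH us sz us_dead.
have [t1|/off_support_block//] := pselect (type1 gs K (fresh us)).
have [short|long] := leqP (size us) (s_card gs K).
  apply: flatten_fresh; apply: I_gen4; exists (fresh us); split=> //.
  - split=> //; last exact: uniq_fresh.
    rewrite -size_eq0 size_mkseq size_eq0; apply/eqP => us0.
    by have /forallP/(_ k0) := us_dead; rewrite us0 /= inS_gs.
  - move=> v vR; apply: (dead_TG gs_inj) => [|x]; last by have [] := vR x.
    by rewrite alpha_fresh.
  - by rewrite size_mkseq (leq_trans short) // s_card_lambda.
have [i [j [ij jus Pij]]] := type1_repeat t1 long.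
(* The second visit j is interior, which is what allows gluing at j. *)
case: j ij jus Pij => [//|j] ij jus Pij.
have usE : us = take j us ++ nth [::] us j :: nth [::] us j.+1 :: drop j.+2 us.
  by rewrite -(drop_nth _ jus) -drop_nth ?cat_take_drop // ltnW.
rewrite usE in us_dead; rewrite usE.
have -> : flatten (take j us ++ nth [::] us j :: nth [::] us j.+1 :: drop j.+2 us) =
    flatten (take j us ++ (nth [::] us j ++ nth [::] us j.+1) :: drop j.+2 us).
  by rewrite !flatten_cat /= -!catA.
have sj : size (take j us) = j by rewrite size_takel // ltnW // ltnW.
apply: IH.
  have szE := congr1 size usE; rewrite szE !size_cat /= !addnS in sz.
  by rewrite size_cat /= addnS.
apply: dead_merge us_dead; first by rewrite sj; exact: ij.
rewrite take_takel // Pij; congr deg.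
by rewrite (take_nth [::]) ?(ltnW jus) // -cats1 flatten_cat /= cats0.
Qed.

Lemma dead_mon w : dead gs (map (@alpha G) w) -> I (mon K w).
Proof.
move=> wdead; have := @dead_flatten (map (fun x => [:: x]) w).
rewrite -map_comp flatten_seq1; apply.
rewrite (eq_map (g := @alpha G)) // => x /=.
by rewrite deg_cons deg_nil mulg1.
Qed.
End DeadWords.

(** * Polynomial functions over an infinite domain *)

Section InfiniteDomain.
Context (K : comNzRingType).
Hypothesis K_inf : infinite_set [set: K].
Hypothesis K_dom : forall x y : K, x * y = 0 -> x = 0 \/ y = 0.

Lemma poly_roots_eq0 (rs : seq K) (p : {poly K}) :
  uniq rs -> all (root p) rs -> (size p <= size rs)%N -> p = 0.
Proof.
elim: rs p => [|a rs IH] p /=; first by rewrite leqn0 size_poly_eq0 => _ _ /eqP.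
move=> /andP[ars urs] /andP[/factor_theorem[q pE] rootp] szp.
suff q0 : q = 0 by rewrite pE q0 mul0r.
apply: contrapT => q0; apply: (q0); apply: IH => //; last first.
  move: szp; rewrite pE size_Mmonic ?monicXsubC //; last exact/eqP.
  by rewrite size_XsubC addn2.
apply/allP => b brs; have /rootP := allP rootp b brs; rewrite pE hornerM hornerXsubC.
case/K_dom => [/rootP //|/subr0_eq ba].
by rewrite -ba brs in ars.
Qed.

Lemma poly_fun_eq0 (p : {poly K}) : (forall x, p.[x] = 0) -> p = 0.
Proof.
move=> p0; have [B _ szB] := infinite_set_fset (size p) K_inf.
by apply: (poly_roots_eq0 (fset_uniq B)) => //; apply/allP => x _; apply/rootP.
Qed.

(** Induction on the variables: freezing all of them but t leaves a polynomial in t that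
    vanishes everywhere, so its coefficients vanish for all values of the other
    variables. *)
Lemma monomials_separate (T : eqType) (vs : seq T) (L : seq (K * seq T)) :
  (forall p, p \in L -> {subset p.2 <= vs}) ->
  (forall y : T -> K, \sum_(p <- L) p.1 * \prod_(t <- p.2) y t = 0) ->
  forall s, \sum_(p <- L | perm_eq p.2 s) p.1 = 0.
Proof.
elim: vs L => [|t vs IH] L Lvs L0 s.
  have Lnil p : p \in L -> p.2 = [::].
    by move/Lvs; case: p.2 => // x r /(_ x); rewrite inE eqxx => /(_ isT).
  rewrite big_seq_cond; case: s => [|x s].
    rewrite -[RHS](L0 (fun=> 0)) [RHS]big_seq; apply: eq_big => [p|p /andP[]].
      by apply: andb_idr => /Lnil ->.
    by move=> /Lnil -> _; rewrite big_nil mulr1.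
  by rewrite big_pred0 // => p; apply/andP => -[/Lnil -> /perm_size].
pose rest := filter (predC1 t).
have permE r : perm_eq r s =
    (count_mem t r == count_mem t s) && perm_eq (rest r) (rest s).
  apply/idP/andP => [rs|[/eqP rst rs]].
    by rewrite (permP rs) eqxx; split=> //; apply: perm_filter.
  rewrite /perm_eq; apply/allP => x _ /=; have [->|xt] := eqVneq x t.
    exact/eqP.
  have crest r' : count_mem x r' = count_mem x (rest r').
    rewrite count_filter; apply: eq_count => z /=.
    by case: eqP => // ->; rewrite xt.
  by rewrite (crest r) (crest s) (permP rs).
have prod_rest (y : T -> K) z r :
    \prod_(u <- r) (if u == t then z else y u) =
    (\prod_(u <- rest r) y u) * z ^+ count_mem t r.
  elim: r => [|u r IHr]; first by rewrite !big_nil mulr1.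
  rewrite big_cons IHr /=; case: eqP => _ /=; first by rewrite exprS mulrCA.
  by rewrite big_cons mulrA.
under eq_bigl => p do rewrite permE.
pose L' := [seq (p.1, rest p.2) | p <- L & count_mem t p.2 == count_mem t s].
rewrite -[RHS](IH L' _ _ (rest s)) ?big_map ?big_filter_cond //.
  move=> _ /mapP[p + ->] u /=; rewrite !mem_filter => /andP[_ /Lvs pvs] /andP[].
  by move=> /= /negbTE ut /pvs; rewrite inE ut.
move=> y; rewrite big_map big_filter /=.
(* q collects the terms by their degree in t. *)
pose q := \sum_(p <- L) (p.1 * \prod_(u <- rest p.2) y u) *: 'X^(count_mem t p.2).
have q0 : q = 0.
  apply: poly_fun_eq0 => z; rewrite -[RHS](L0 (fun u => if u == t then z else y u)).
  rewrite horner_sum; apply: eq_bigr => p _.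
  by rewrite hornerZ hornerXn prod_rest mulrA.
have := congr1 (fun r : {poly K} => r`_(count_mem t s)) q0.
rewrite coef0 coef_sum => qs; rewrite -[RHS]qs big_mkcond; apply: eq_bigr => p _.
by rewrite coefZ coefXn eq_sym; case: eqP; rewrite ?mulr1 ?mulr0.
Qed.

Lemma separating_field (G : groupType) (n : nat) (gs : 'I_n -> G) :
  separating gs (idfun : K -> K) setT.
Proof.
move=> L _ L0 s _; apply: (@monomials_separate _ (flatten (map snd L))).
  by move=> p pL e ep; apply/flattenP; exists p.2; first exact: map_f.
by move=> y; apply: L0.
Qed.
End InfiniteDomain.

(** * The graded identities *)

Theorem theorem6p9 (G : groupType) (n : nat) (hn : (1 <= n)%N)
    (gs : 'I_n -> G) (gs_inj : injective gs) (K : comNzRingType) :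
  TG (iotaOmega G n K) (R_comp gs K) = U_ideal gs K
  /\ (infinite_set [set: K] ->
      (forall x y : K, x * y = 0 -> x = 0 \/ y = 0) ->
      TG (iotaK n K) (elem_comp gs K) = U_ideal gs K).
Proof.
pose k0 : 'I_n := Ordinal hn.
have complete (S : comNzRingType) (rho : {rmorphism K -> S})
    (iota : {rmorphism K -> 'M[S]_n}) Y f :
    (forall c, iota c = (rho c)%:M) -> separating gs rho Y ->
    (forall y, Y y -> feval iota (path_mx gs y) f = 0) -> U_ideal gs K f.
  move=> iotaE sepY fY I [ITG Igen].
  have [I1 I2 I3 I4] : [/\ @gen1 G K `<=` I, @gen2 G K `<=` I,
      @gen3 G n gs K `<=` I & @gen4 G n gs K `<=` I].
    by split=> h hgen; apply: Igen; [do 3 left|do 2 left; right|left; right|right].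
  apply: (completeness gs_inj iotaE sepY fY ITG I1 I2) => w.
  exact: (dead_mon gs_inj k0 ITG I3 I4).
have sound (S : comNzRingType) (rho : {rmorphism K -> S})
    (iota : {rmorphism K -> 'M[S]_n}) :
    (forall c, iota c = (rho c)%:M) ->
    U_ideal gs K `<=` TG iota (elem_comp gs S).
  move=> iotaE; have central := iota_central iotaE.
  have diag := iota_diag iotaE.
  apply: smallest_sub; first exact: TG_ideal_elem_comp.
  move=> f [[[]|]|].
  - exact: gen1_TG.
  - exact: gen2_TG.
  - exact: (gen3_TG gs_inj k0).
  - exact: (gen4_TG gs_inj k0).
split=> [|K_inf K_dom]; apply/seteqP; split.
- move=> f /(feval_gen_eq0 gs_inj k0) f0.
  have fY y : [set y_gen gs K k0] y ->
    feval (iotaOmega G n K) (path_mx gs y) f = 0 by move=> ->.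
  exact: (complete _ _ (iotaOmega G n K) _ f (fun=> erefl)
    (@separating_gen _ _ _ K gs_inj k0) fY).
- move=> f /(sound _ _ (iotaOmega G n K) (fun=> erefl)) Uf v vR.
  by apply: Uf => x; have [] := vR x.
- move=> f f0; have fY y : setT y -> feval (iotaK n K) (path_mx gs y) f = 0.
    by move=> _; apply: f0 => x; exact: path_mx_comp.
  exact: (complete K idfun (iotaK n K) _ f (fun=> erefl)
    (@separating_field _ K_inf K_dom _ _ gs) fY).
- exact: (sound _ idfun (iotaK n K)).
Qed.
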